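(* Let $m>3$, $n\ge 3$ and $l\ge -1$ be integers. Then $$X_{D(m,l,n)}=X_{D(m-1,l+1,n)}+X_{T_{n,m+l}}-X_{T_{n,l+1}}X_{C_{m-1}}.$$
   Context: All graphs are finite and simple; $C_n$ is the cycle and $P_l$ the path on the indicated number of vertices. For $m,n\ge 3$ and $l\ge 2$, the dumbbell graph $D(m,l,n)$ consists of disjoint $C_m$, $C_n$ and $P_l$, with one leaf of $P_l$ connected by an edge to one vertex of $C_m$ and the other leaf connected by an edge to one vertex of $C_n$. For $l=1$, the single vertex of $P_1$ is adjacent to one vertex of $C_m$ and to one vertex of $C_n$. For $l=0$, $D(m,0,n)$ is $C_m$ and $C_n$ (disjoint) connected by an edge. For $l=-1$, $D(m,-1,n)$ is $C_m$ and $C_n$ sharing exactly one vertex. For $a\ge 3$, $b\ge 1$, the tadpole graph $T_{a,b}$ is obtained by connecting by an edge one vertex of $C_a$ and one leaf of $P_b$ (the single vertex if $b=1$); by convention $T_{a,0}=C_a$. The chromatic symmetric function of a graph $G$ with vertices $v_1,\ldots,v_d$ is $X_G=\sum_{\kappa} x_{\kappa(v_1)}\cdots x_{\kappa(v_d)}$, the sum over all proper colourings $\kappa:V(G)\to\mathbb{N}$, with $x_1,x_2,\ldots$ commuting variables. *)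

(* Defs.v *)
From HB Require Import structures.
From mathcomp Require Import all_boot all_order all_algebra.
From mathcomp Require Import finmap monalg boolp.

Set Implicit Arguments.
Unset Strict Implicit.
Unset Printing Implicit Defensive.

Import GRing.Theory.
Local Open Scope ring_scope.

(* Formal power series over int in the commuting variables U_(0), U_(1), ...
   A monomial is an element of {cmonom nat}, the free commutative monoid on
   nat, and a series is its coefficient function; the ring structure installed
   below has the Cauchy product as multiplication. *)

Definition submonom (m : {cmonom nat})
    (k : {ffun finsupp m -> 'I_(mdeg m).+1}) : {cmonom nat} :=
  [cmonom (k i : nat) | i : finsupp m]%M.

Definition mdivisors (m : {cmonom nat}) : {fset {cmonom nat}} :=
  [fset d in [fset submonom k | k : {ffun finsupp m -> 'I_(mdeg m).+1}]
     | mmul d (divcm m d) == m]%fset.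

Lemma mdivisorsP (m d : {cmonom nat}) :
  reflect (exists e, mmul d e = m) (d \in mdivisors m).
Proof.
apply: (iffP idP) => [|[e dem]].
  by rewrite !inE => /andP[_ /eqP dm]; exists (divcm m d).
have dm i : (d i <= m i)%N by rewrite -dem cmM leq_addr.
have mdm i : (m i <= mdeg m)%N.
  by case: mdomP => // im; rewrite mdegE (big_fsetD1 i) //= leq_addr.
rewrite !inE /=; apply/andP; split; last first.
  by apply/eqP/eqP/cmP => i; rewrite cmM divcmE subnKC.
apply/imfsetP; exists [ffun i => inord (d (val i))] => //=.
apply/eqP/cmP => i; rewrite cmE fsfun_ffun.
case: insubP => [u _ <-|].
  by rewrite /= ffunE inordK // ltnS (leq_trans (dm _)).
rewrite memNfinsupp => /eqP mi0 /=; apply/eqP.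
by have := dm i; rewrite [m i]mi0 leqn0.
Qed.

Record series := Series { coef : {cmonom nat} -> int }.

Definition smul (f g : series) : series :=
  Series (fun m => \sum_(a <- mdivisors m)
                   \sum_(b <- mdivisors m | mmul a b == m) coef f a * coef g b).

Lemma seriesP (f g : series) : coef f =1 coef g -> f = g.
Proof. by case: f g => [f] [g] /= /funext ->. Qed.

HB.instance Definition _ := gen_eqMixin series.
HB.instance Definition _ := gen_choiceMixin series.

Section SeriesRing.
Implicit Types f g h : series.
Implicit Types (m a b d e : {cmonom nat}) (D : {fset {cmonom nat}}).

Definition szero := Series (fun=> 0).
Definition sone := Series (fun m => (m == mone)%:R).
Definition sadd f g := Series (fun m => coef f m + coef g m).
Definition sopp f := Series (fun m => - coef f m).

Fact saddA : associative sadd.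
Proof. by move=> f g h; apply: seriesP => m /=; rewrite addrA. Qed.

Fact saddC : commutative sadd.
Proof. by move=> f g; apply: seriesP => m /=; rewrite addrC. Qed.

Fact sadd0 : left_id szero sadd.
Proof. by move=> f; apply: seriesP => m /=; rewrite add0r. Qed.

Fact saddN : left_inverse szero sopp sadd.
Proof. by move=> f; apply: seriesP => m /=; rewrite addNr. Qed.

HB.instance Definition _ :=
  GRing.isZmodule.Build series saddA saddC sadd0 saddN.

Lemma mdivisorsl a b : a \in mdivisors (mmul a b).
Proof. by apply/mdivisorsP; exists b. Qed.

Lemma mdivisorsr a b : b \in mdivisors (mmul a b).
Proof. by rewrite mulmC mdivisorsl. Qed.

Lemma smul_widen D f g m : (mdivisors m `<=` D)%fset ->
  coef (smul f g) m =
  \sum_(a <- D) \sum_(b <- D) (mmul a b == m)%:R * (coef f a * coef g b).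
Proof.
have E S : \sum_(a <- S) \sum_(b <- S | mmul a b == m) coef f a * coef g b =
  \sum_(a <- S) \sum_(b <- S) (mmul a b == m)%:R * (coef f a * coef g b).
  apply: eq_bigr => a _; rewrite big_mkcond; apply: eq_bigr => b _.
  by case: eqP; rewrite (mul0r, mul1r).
move=> sD; rewrite /= E (big_fset_incl _ sD) /=; last first.
  move=> a _ aNm; rewrite big1_fset // => b _ _.
  have [abm|_] := mmul a b =P m; last by rewrite mul0r.
  by case/mdivisorsP: aNm; exists b.
apply: eq_bigr => a _; apply: (big_fset_incl _ sD) => b _ bNm.
have [abm|_] := mmul a b =P m; last by rewrite mul0r.
by case/mdivisorsP: bNm; exists a; rewrite mulmC.
Qed.

Lemma mdivisors_sub m d : d \in mdivisors m -> (mdivisors d `<=` mdivisors m)%fset.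
Proof.
case/mdivisorsP => e <-; apply/fsubsetP => a /mdivisorsP[b <-].
by rewrite -mulmA mdivisorsl.
Qed.

Lemma sum_ind D (d m : {cmonom nat}) (F : {cmonom nat} -> int) :
  (d \notin D -> F d = 0) -> \sum_(a <- D) (d == a)%:R * F a = F d.
Proof.
move=> Fd; have [dD|dND] := boolP (d \in D).
  rewrite (big_fsetD1 d) //= eqxx mul1r big1_fset ?addr0 // => a.
  by rewrite in_fsetD1 eq_sym => /andP[/negPf-> _] _; rewrite mul0r.
rewrite Fd // big1_fset // => a aD _.
by case: eqP aD dND => [<- ->|]; rewrite ?mul0r.
Qed.

Fact smulC : commutative smul.
Proof.
move=> f g; apply: seriesP => m.
rewrite !(smul_widen _ _ (fsubset_refl (mdivisors m))) exchange_big /=.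
by apply: eq_bigr => a _; apply: eq_bigr => b _; rewrite mulmC [coef f _ * _]mulrC.
Qed.

Lemma coef_smul3 f g h m (D := mdivisors m) :
  coef (smul (smul f g) h) m =
  \sum_(a <- D) \sum_(b <- D) \sum_(c <- D)
    (mmul (mmul a b) c == m)%:R * (coef f a * coef g b * coef h c).
Proof.
rewrite (smul_widen _ _ (fsubset_refl D)).
transitivity (\sum_(d <- D) \sum_(c <- D) \sum_(a <- D) \sum_(b <- D)
  (mmul a b == d)%:R * ((mmul d c == m)%:R * (coef f a * coef g b * coef h c))).
  rewrite big_seq [RHS]big_seq; apply: eq_bigr => d dD; apply: eq_bigr => c _.
  rewrite (smul_widen _ _ (mdivisors_sub dD)) mulr_suml mulr_sumr.
  apply: eq_bigr => a _; rewrite mulr_suml mulr_sumr; apply: eq_bigr => b _.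
  by rewrite -[X in _ * X]mulrA mulrCA.
rewrite exchange_big /=; under eq_bigr do rewrite exchange_big /=.
rewrite exchange_big /=; apply: eq_bigr => a _.
under eq_bigr do rewrite exchange_big /=.
rewrite exchange_big /=; apply: eq_bigr => b _; apply: eq_bigr => c _.
rewrite (@sum_ind D (mmul a b) m
  (fun d => (mmul d c == m)%:R * (coef f a * coef g b * coef h c))) //.
have [abcm|_] := mmul (mmul a b) c =P m; last by rewrite mul0r.
by case/mdivisorsP; exists c.
Qed.

Fact smulA : associative smul.
Proof.
move=> f g h; rewrite smulC; apply: seriesP => m; rewrite !coef_smul3.
under eq_bigr do rewrite exchange_big /=.
rewrite exchange_big /=; apply: eq_bigr => a _.
apply: eq_bigr => b _; apply: eq_bigr => c _.
rewrite mulmC mulmA; congr (_ * _).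
by rewrite [LHS]mulrC mulrA.
Qed.

Fact smul1 : left_id sone smul.
Proof.
move=> f; apply: seriesP => m; set D := mdivisors m.
have mulmm : mmul mone m = m by exact: mul1m.
have mD : m \in D by apply/mdivisorsP; exists mone; rewrite mulmC.
have oneD : mone \in D by apply/mdivisorsP; exists m.
rewrite (smul_widen _ _ (fsubset_refl D)) (big_fsetD1 mone) //=.
rewrite [X in _ + X]big1_fset ?addr0; last first.
  move=> a; rewrite in_fsetD1 => /andP[/negPf a1 _] _.
  by rewrite big1 // => b _; rewrite a1 mul0r mulr0.
rewrite (big_fsetD1 m) //= mulmm !eqxx !mul1r big1_fset ?addr0 // => b.
by rewrite in_fsetD1 mul1m => /andP[/negPf-> _] _; rewrite mul0r.
Qed.

Fact smulDl : left_distributive smul sadd.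
Proof.
move=> f g h; apply: seriesP => m /=; rewrite -big_split /=.
apply: eq_bigr => a _; rewrite -big_split /=.
by apply: eq_bigr => b _; rewrite mulrDl.
Qed.

Fact sone_neq0 : sone != szero.
Proof. by apply/eqP => /(congr1 (fun f => coef f mone)); rewrite /= eqxx. Qed.

HB.instance Definition _ := GRing.Zmodule_isComNzRing.Build series
  smulA smulC smul1 smulDl sone_neq0.

End SeriesRing.

Record sgraph := SGraph {
  vertex : finType;
  adj : rel vertex;
  adj_sym : symmetric adj;
  adj_irrefl : irreflexive adj
}.

Definition proper (G : sgraph) (kappa : {ffun vertex G -> nat}) : bool :=
  [forall u, forall v, adj u v ==> (kappa u != kappa v)].

Definition colour_monom (G : sgraph) (kappa : {ffun vertex G -> nat}) :
    {cmonom nat} :=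
  \big[mmul/mone]_(v : vertex G) ucm (kappa v).

Definition forget_supp (G : sgraph) (m : {cmonom nat})
    (k : {ffun vertex G -> finsupp m}) : {ffun vertex G -> nat} :=
  [ffun v => val (k v)].

Definition colourings (G : sgraph) (m : {cmonom nat}) :
    {fset {ffun vertex G -> nat}} :=
  [fset kappa in [fset forget_supp k | k : {ffun vertex G -> finsupp m}]
     | proper kappa && (colour_monom kappa == m)]%fset.

(* Restricting the colours to finsupp m in colourings loses nothing. *)
Lemma colouringsE (G : sgraph) (m : {cmonom nat}) (kappa : {ffun vertex G -> nat}) :
  (kappa \in colourings G m) = proper kappa && (colour_monom kappa == m).
Proof.
rewrite !inE /= andb_idl // => /andP[_ /eqP km].
have km_supp v : kappa v \in finsupp m.
  by rewrite -km /colour_monom (bigD1 v) //= mdomD mdomU in_fsetU in_fset1 eqxx.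
apply/imfsetP; exists [ffun v => [` km_supp v]%fset] => //=.
by apply/ffunP => v; rewrite !ffunE.
Qed.

(* The sum of colour_monom kappa over all proper kappa : V(G) -> nat, which is
   infinite, given by its coefficients. *)
Definition chromsym (G : sgraph) : series :=
  Series (fun m => (#|` colourings G m|)%:Z).

(* Vertex type 'I_k.-1.+1, which is 'I_k for k > 0, so that ord0 is a vertex
   with no hypothesis on k; this is C_k for k >= 3. *)
Definition cycle_adj k : rel 'I_k.-1.+1 :=
  fun i j => (i != j) && ((j == ordS i) || (i == ordS j)).

Fact cycle_sym k : symmetric (@cycle_adj k).
Proof. by move=> i j; rewrite /cycle_adj eq_sym orbC. Qed.

Fact cycle_irrefl k : irreflexive (@cycle_adj k).
Proof. by move=> i; rewrite /cycle_adj eqxx. Qed.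

Definition cycle_graph k := SGraph (@cycle_sym k) (@cycle_irrefl k).

Definition path_adj k : rel 'I_k :=
  fun i j => (j == i.+1 :> nat) || (i == j.+1 :> nat).

Fact path_sym k : symmetric (@path_adj k).
Proof. by move=> i j; rewrite /path_adj orbC. Qed.

Fact path_irrefl k : irreflexive (@path_adj k).
Proof. by move=> i; rewrite /path_adj -[X in X == _]addn0 -addn1 eqn_add2l. Qed.

Definition path_graph k := SGraph (@path_sym k) (@path_irrefl k).

(* The disjoint union of G and H plus the edge {u, v}. *)
Section Link.
Variables (G H : sgraph) (u : vertex G) (v : vertex H).

Definition link_adj : rel (vertex G + vertex H)%type := fun x y =>
  match x, y with
  | inl a, inl b => adj a b
  | inr a, inr b => adj a b
  | inl a, inr b | inr b, inl a => (a == u) && (b == v)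
  end.

Fact link_sym : symmetric link_adj.
Proof. by case=> a [] b //=; rewrite adj_sym. Qed.

Fact link_irrefl : irreflexive link_adj.
Proof. by case=> a /=; rewrite adj_irrefl. Qed.

Definition link := SGraph link_sym link_irrefl.
End Link.

(* G and H sharing exactly one vertex: v is deleted from H and its neighbours
   are attached to u instead. *)
Section Wedge.
Variables (G H : sgraph) (u : vertex G) (v : vertex H).

Definition wedge_adj : rel (vertex G + {y : vertex H | y != v})%type := fun x y =>
  match x, y with
  | inl a, inl b => adj a b
  | inr a, inr b => adj (val a) (val b)
  | inl a, inr b | inr b, inl a => (a == u) && adj v (val b)
  end.

Fact wedge_sym : symmetric wedge_adj.
Proof. by case=> a [] b //=; rewrite adj_sym. Qed.

Fact wedge_irrefl : irreflexive wedge_adj.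
Proof. by case=> a /=; rewrite adj_irrefl. Qed.

Definition wedge := SGraph wedge_sym wedge_irrefl.
End Wedge.

Definition tadpole (a b : nat) : sgraph :=
  if b is b'.+1
  then @link (cycle_graph a) (path_graph b'.+1) ord0 ord0
  else cycle_graph a.

(* The path is attached by its vertex ord0 to C_m and by ord_max to C_n; these
   coincide when l = 1.  Values l < -1 are junk, treated as l = -1. *)
Definition dumbbell (m : nat) (l : int) (n : nat) : sgraph :=
  match l with
  | Posz l'.+1 =>
      @link (@link (cycle_graph m) (path_graph l'.+1) ord0 ord0)
        (cycle_graph n) (inr ord_max) ord0
  | Posz 0 => @link (cycle_graph m) (cycle_graph n) ord0 ord0
  | Negz _ => @wedge (cycle_graph m) (cycle_graph n) ord0 ord0
  end.

(* Main.v *)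
Require Import Defs.
From mathcomp Require Import all_boot all_order all_algebra.
From mathcomp Require Import finmap monalg zify.

Set Implicit Arguments.
Unset Strict Implicit.
Unset Printing Implicit Defensive.

Import GRing.Theory.
Local Open Scope ring_scope.

(** The proof is a deletion argument on edges.  Let [a], [b], [c] be distinct
    vertices of a graph [S] in which none of the edges [ab], [ac], [bc] is
    present.  For every colouring of the vertices, writing [xy] also for the
    truth value of: x and y get different colours,
      [ab * ac + bc = ac * bc + ab],
    because [ab = bc] and [ac = 0] when [a] and [c] get the same colour, while
    [ac = 1] when they do not.
    Summing over the proper colourings of [S] gives
      [X_(S+ab+ac) = X_(S+ac+bc) + X_(S+ab) - X_(S+bc)]
    (lemma [triple_deletion]).

    Apply this in D(m,l,n) with [a] the vertex of C_m where the rest of the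
    graph is attached, [b] and [c] its two neighbours on C_m, and [S] what is
    left after deleting [ab] and [ac].  Then [S] is the disjoint union of
    T_(n,l+1), ending in [a], and of a path from [b] to [c] on m-1 vertices.
    - S+ab+ac is the dumbbell D(m,l,n) itself.
    - In S+ac+bc the path is closed into C_(m-1) and hangs from [a] by the edge
      [ac]: this is D(m-1,l+1,n).
    - In S+ab the path extends the tail of the tadpole: this is T_(n,m+l).
    - S+bc is the disjoint union of T_(n,l+1) and C_(m-1), and the chromatic
      symmetric function of a disjoint union is a product
      (lemma [chromsym_disjoint]).

    To avoid composing explicit isomorphisms between nested sums of ordinals,
    every graph is compared with a graph on the numbers 0 .. N-1, where
    N = n + m + l, through an injective numbering of its vertices
    (lemma [chromsym_label]).  In the common picture C_n is 0 .. n-1, the tail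
    follows and ends in [a = s], and the path from [b] to [c] is s+1 .. N-1.
    The four identifications then reduce to linear arithmetic. *)

Local Notation proper := Defs.proper.

(** * Counting in finite sets *)

Lemma in_fset_sep (T : choiceType) (U : {fset T}) (P : pred T) (k : T) :
  (k \in [fset x in U | P x]%fset) = (k \in U) && P k.
Proof. by rewrite !inE. Qed.

Lemma card_fset_pred (T : choiceType) (A U : {fset T}) (P : pred T) :
  (forall k, (k \in A) = (k \in U) && P k) ->
  #|` A|%fset%:Z = \sum_(k <- U) (P k)%:Z.
Proof.
move=> AE; have -> : A = [fset k in U | P k]%fset.
  by apply/fsetP => k; rewrite AE in_fset_sep.
rewrite card_fset_sum1 -big_fset_condE /= -natz natr_sum big_mkcond /=.
by apply: eq_bigr => k _; case: ifP.
Qed.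

Lemma card_fset_prod (S T : choiceType) (A : {fset S}) (B : {fset T}) :
  #|` A `*` B|%fset = (#|` A| * #|` B|)%N.
Proof.
rewrite -(size_allpairs pair A B); apply/perm_size/uniq_perm.
- exact: fset_uniq.
- by apply: allpairs_uniq => // -[x y] [x' y'] _ _ [-> ->].
move=> [x y]; rewrite in_fsetM; apply/andP/allpairsP => /= [[xA yB]|].
  by exists (x, y).
by case=> -[x' y'] /= [xA yB [-> ->]].
Qed.

(** * Invariance under isomorphism *)

Lemma proper_colouringP (G : sgraph) (kappa : {ffun vertex G -> nat}) :
  reflect (forall u v, adj u v -> kappa u != kappa v) (proper kappa).
Proof. by apply: (iffP 'forall_'forall_implyP). Qed.

Lemma chromsym_iso (G H : sgraph) (f : vertex G -> vertex H) :
  bijective f -> (forall u v, adj (f u) (f v) = adj u v) ->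
  chromsym G = chromsym H.
Proof.
move=> bf adjf; have [g fK gK] := bf.
apply: seriesP => m /=; congr Posz.
pose pull (kappa : {ffun vertex H -> nat}) : {ffun vertex G -> nat} :=
  [ffun u => kappa (f u)].
have pull_inj : injective pull.
  move=> k1 k2 /ffunP k12; apply/ffunP => v.
  by have := k12 (g v); rewrite !ffunE gK.
transitivity #|` [fset pull k | k in colourings H m]|%fset; last first.
  exact: card_imfset.
congr #|` _|%fset; apply/fsetP => kappa; rewrite colouringsE.
apply/andP/imfsetP => /= [[/proper_colouringP pk /eqP mk]|[k]].
  exists [ffun v => kappa (g v)]; last first.
    by apply/ffunP => u; rewrite !ffunE fK.
  rewrite colouringsE; apply/andP; split.
    apply/proper_colouringP => u v uv; rewrite !ffunE.
    by apply: pk; rewrite -adjf !gK.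
  rewrite -mk; apply/eqP; rewrite /colour_monom (reindex f); last first.
    exact: onW_bij.
  by apply: eq_bigr => u _; rewrite ffunE fK.
rewrite colouringsE => /andP[/proper_colouringP pk /eqP mk] ->; split.
  by apply/proper_colouringP => u v uv; rewrite !ffunE; apply: pk; rewrite adjf.
rewrite -mk; apply/eqP; rewrite /colour_monom [RHS](reindex f); last first.
  exact: onW_bij.
by apply: eq_bigr => u _; rewrite ffunE.
Qed.

(** * Graphs given by numbering their vertices *)

Section EdgeGraph.
Variables (N : nat) (e : rel nat).

(** Only the values of [e] on pairs [i < j] count, so that [e] can list each
    edge once and the symmetric closure is free. *)
Definition edge_adj : rel 'I_N := fun i j =>
  if (i < j)%N then e i j else (j < i)%N && e j i.

Fact edge_sym : symmetric edge_adj.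
Proof. by move=> i j; rewrite /edge_adj; case: ltngtP. Qed.

Fact edge_irrefl : irreflexive edge_adj.
Proof. by move=> i; rewrite /edge_adj ltnn. Qed.

Definition edge_graph := SGraph edge_sym edge_irrefl.
End EdgeGraph.

(** The numbering need not be shown surjective: that follows by counting. *)
Lemma chromsym_label (G : sgraph) (N : nat) (e : rel nat)
    (f : vertex G -> nat) :
  #|vertex G| = N -> injective f -> (forall u, (f u < N)%N) ->
  (forall u v, (f u < f v)%N -> adj u v = e (f u) (f v)) ->
  chromsym G = chromsym (edge_graph N e).
Proof.
move=> cG injf ltf adjf.
pose g u : vertex (edge_graph N e) := Ordinal (ltf u).
apply: (@chromsym_iso _ _ g) => [|u v].
  apply: inj_card_bij; last by rewrite card_ord cG.
  by move=> u v /(congr1 val) /= /injf.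
rewrite /= /edge_adj /=; case: (ltngtP (f u) (f v)) => [uv|uv|/injf->].
- by rewrite adjf.
- by rewrite [RHS]adj_sym adjf.
- by rewrite adj_irrefl.
Qed.

(** * Triple deletion *)

Definition edge (a b : nat) : rel nat := fun i j => (i == a) && (j == b).

Lemma proper_edgeU N (e : rel nat) (a b : 'I_N) (kappa : {ffun 'I_N -> nat}) :
  (a < b)%N ->
  @proper (edge_graph N (relU e (edge a b))) kappa =
  @proper (edge_graph N e) kappa && (kappa a != kappa b).
Proof.
move=> ab; apply/proper_colouringP/andP => [pk|[/proper_colouringP pk kab] u v].
  split; last by apply: pk; rewrite /= /edge_adj ab /= /edge !eqxx orbT.
  apply/proper_colouringP => u v; move=> uv; apply: pk; move: uv.
  by rewrite /= /edge_adj /=; case: ltngtP => //= _ ->.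
have key (i j : 'I_N) :
    (i < j)%N -> (e i j || edge a b i j) -> kappa i != kappa j.
  move=> ij /orP[eij|/andP[/eqP/val_inj-> /eqP/val_inj->] //].
  by apply: pk; rewrite /= /edge_adj ij.
rewrite /= /edge_adj /=; case: ltngtP => //= uv; first exact: key.
by move=> euv; rewrite eq_sym key.
Qed.

(** Summing over all colourings of the edgeless graph makes the index set
    independent of [e], so that graphs with the same vertices can be compared
    colouring by colouring. *)
Lemma coef_chromsym_edge N (e : rel nat) (m : {cmonom nat}) :
  coef (chromsym (edge_graph N e)) m =
  \sum_(kappa <- colourings (edge_graph N [rel _ _ | false]) m)
    (@proper (edge_graph N e) kappa)%:Z.
Proof.
pose U := colourings (edge_graph N [rel _ _ | false]) m.
have memU k : (k \in U) = (colour_monom k == m).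
  rewrite colouringsE andb_idl // => _.
  by apply/proper_colouringP => u v /=; rewrite /edge_adj /= andbF if_same.
apply: (@card_fset_pred _ _ U (fun k => @proper (edge_graph N e) k)) => k.
by rewrite memU andbC; exact: (@colouringsE (edge_graph N e) m k).
Qed.

(** Both sides count, over the proper colourings for [e], the same truth
    values, once the last term is moved to the left: if [a] and [c] have
    different colours the identity reads [ab + bc = bc + ab], and if they have
    the same colour it reads [bc = ab]. *)
Lemma triple_deletion N (e : rel nat) (a b c : 'I_N) :
  (a < b)%N -> (b < c)%N ->
  chromsym (edge_graph N (relU (relU e (edge a b)) (edge a c))) =
  chromsym (edge_graph N (relU (relU e (edge a c)) (edge b c)))
  + chromsym (edge_graph N (relU e (edge a b)))
  - chromsym (edge_graph N (relU e (edge b c))).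
Proof.
move=> ab bc; have ac := ltn_trans ab bc; apply: seriesP => m.
have coefB f g h : coef (f + g - h) m = coef f m + coef g m - coef h m by [].
rewrite coefB !coef_chromsym_edge -sumrN -!big_split.
apply: eq_bigr => kappa _ /=; rewrite !proper_edgeU //.
case: (proper _); last by [].
case: (eqVneq (kappa a) (kappa c)) => [->|_] /=.
  by rewrite andbF [kappa c == _]eq_sym; case: (kappa b == _).
by case: (kappa a == _); case: (kappa b == _).
Qed.

(** * Disjoint unions *)

Section Disjoint.
Variables G H : sgraph.

Definition disjoint_adj : rel (vertex G + vertex H)%type := fun x y =>
  match x, y with
  | inl a, inl b => adj a b
  | inr a, inr b => adj a b
  | _, _ => false
  end.

Fact disjoint_sym : symmetric disjoint_adj.
Proof. by case=> a [] b //=; rewrite adj_sym. Qed.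

Fact disjoint_irrefl : irreflexive disjoint_adj.
Proof. by case=> a /=; rewrite adj_irrefl. Qed.

Definition disjoint_union := SGraph disjoint_sym disjoint_irrefl.

Definition glue (k : {ffun vertex G -> nat} * {ffun vertex H -> nat}) :
    {ffun vertex disjoint_union -> nat} :=
  [ffun x => match x with inl u => k.1 u | inr v => k.2 v end].

Definition lpart (kappa : {ffun vertex disjoint_union -> nat}) :
  {ffun vertex G -> nat} := [ffun u => kappa (inl u)].

Definition rpart (kappa : {ffun vertex disjoint_union -> nat}) :
  {ffun vertex H -> nat} := [ffun v => kappa (inr v)].

Lemma lpart_glue k : lpart (glue k) = k.1.
Proof. by apply/ffunP => u; rewrite !ffunE. Qed.

Lemma rpart_glue k : rpart (glue k) = k.2.
Proof. by apply/ffunP => u; rewrite !ffunE. Qed.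

Lemma glue_inj : injective glue.
Proof.
move=> [k1 k2] [k1' k2'] E; congr (_, _).
  by have := congr1 lpart E; rewrite !lpart_glue.
by have := congr1 rpart E; rewrite !rpart_glue.
Qed.

Lemma glueE kappa : glue (lpart kappa, rpart kappa) = kappa.
Proof. by apply/ffunP => -[] u; rewrite !ffunE. Qed.

Lemma proper_glue k : proper (glue k) = proper k.1 && proper k.2.
Proof.
apply/proper_colouringP/andP => [pk|[]]; last first.
  move=> /proper_colouringP p1 /proper_colouringP p2.
  by case=> u [] v //= uv; rewrite !ffunE; [apply: p1 | apply: p2].
split; apply/proper_colouringP => u v uv.
  by have := pk (inl u) (inl v) uv; rewrite !ffunE.
by have := pk (inr u) (inr v) uv; rewrite !ffunE.
Qed.

Lemma colour_monom_glue k :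
  colour_monom (glue k) = mmul (colour_monom k.1) (colour_monom k.2).
Proof.
rewrite /colour_monom big_sumType /=.
by congr mmul; apply: eq_bigr => u _; rewrite ffunE.
Qed.

(** A pair of proper colourings of the parts is a proper colouring of the union,
    and the monomials multiply; hence the colourings of the union with monomial
    [m] split according to the factorizations [m = a b]. *)
Lemma card_colourings_disjoint a b m :
  #|` [fset kappa in colourings disjoint_union m |
        (colour_monom (lpart kappa) == a) &&
        (colour_monom (rpart kappa) == b)]|%fset =
  ((mmul a b == m) * (#|` colourings G a| * #|` colourings H b|))%N.
Proof.
case: eqP => [abm|abm]; last first.
  rewrite mul0n; apply/eqP; rewrite cardfs_eq0; apply/eqP/fsetP => kappa.
  rewrite in_fset0 in_fset_sep colouringsE.
  rewrite -[X in colour_monom X == m]glueE colour_monom_glue.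
  apply/negP => /andP[/andP[_ /eqP km] /andP[/eqP ea /eqP eb]].
  by apply: abm; rewrite -km ea eb.
rewrite mul1n -card_fset_prod.
transitivity #|` [fset glue k | k in colourings G a `*` colourings H b]|%fset;
  last by rewrite (card_imfset _ _ glue_inj).
congr #|` _|%fset; apply/fsetP => kappa; rewrite in_fset_sep colouringsE.
apply/andP/imfsetP => /= [|[[k1 k2]]].
  rewrite -[X in proper X]glueE -[X in colour_monom X == m]glueE.
  rewrite proper_glue => -[/andP[/andP[p1 p2] _] /andP[ea eb]].
  exists (lpart kappa, rpart kappa); rewrite ?glueE // in_fsetM !colouringsE.
  by rewrite p1 p2 ea eb.
rewrite in_fsetM !colouringsE /=.
move=> /andP[/andP[p1 /eqP ea] /andP[p2 /eqP eb]] ->.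
rewrite lpart_glue rpart_glue proper_glue colour_monom_glue.
by rewrite p1 p2 ea eb abm !eqxx.
Qed.

Lemma chromsym_disjoint : chromsym disjoint_union = chromsym G * chromsym H.
Proof.
apply: seriesP => m; set D := mdivisors m.
rewrite [RHS](smul_widen _ _ (fsubset_refl D)) /=.
pose mG k := colour_monom (lpart k); pose mH k := colour_monom (rpart k).
have splitm (k : {ffun vertex disjoint_union -> nat}) :
    k \in colourings disjoint_union m -> mmul (mG k) (mH k) = m.
  rewrite colouringsE => /andP[_ /eqP <-].
  by rewrite -[in RHS](glueE k) colour_monom_glue.
(* Each colouring contributes to exactly one pair of monomials. *)
transitivity (\sum_(k <- colourings disjoint_union m) \sum_(a <- D)
    (mG k == a)%:R * \sum_(b <- D) (mH k == b)%:R * 1%:Z).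
  rewrite card_fset_sum1 -natz natr_sum big_seq [RHS]big_seq.
  apply: eq_bigr => k /splitm km.
  rewrite (@sum_ind D _ m (fun=> \sum_(b <- D) (mH k == b)%:R * 1%:Z)).
    by rewrite (@sum_ind D _ m (fun=> 1%:Z)) // /D -km mdivisorsr.
  by rewrite /D -km mdivisorsl.
rewrite exchange_big; apply: eq_bigr => a _ /=.
under eq_bigr do rewrite mulr_sumr.
rewrite exchange_big; apply: eq_bigr => b _ /=.
transitivity (#|` [fset k in colourings disjoint_union m |
    (mG k == a) && (mH k == b)]|%fset%:Z).
  rewrite (@card_fset_pred _ _ (colourings disjoint_union m)
      (fun k => (mG k == a) && (mH k == b))) => [|k]; last exact: in_fset_sep.
  by apply: eq_bigr => k _; do 2!case: eqP.
by rewrite card_colourings_disjoint !PoszM; case: eqP.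
Qed.

End Disjoint.

(** * Numbering the vertices of cycles, tadpoles and dumbbells *)

Lemma cycle_adjE k (i j : 'I_k.-1.+1) : (3 <= k)%N ->
  cycle_adj i j =
  [|| j == i.+1 :> nat, i == j.+1 :> nat,
      (i == 0%N :> nat) && (j == k.-1 :> nat)
    | (j == 0%N :> nat) && (i == k.-1 :> nat)].
Proof.
move=> k3; have kE : k.-1.+1 = k by lia.
have modS (x : 'I_k.-1.+1) :
    (x.+1 %% k.-1.+1)%N = if x == k.-1 :> nat then 0%N else x.+1.
  have := ltn_ord x; case: eqP => [->|]; rewrite ?modnn // => *.
  by rewrite modn_small //; lia.
rewrite /cycle_adj -!val_eqE /= !modS.
have := ltn_ord i; have := ltn_ord j.
by case: (i =P k.-1 :> nat); case: (j =P k.-1 :> nat); lia.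
Qed.

(** The path 0, 1, 2, ... with the edge from [s] to [s.+1] removed, and with
    the chord that closes its first [n] vertices into a cycle. *)
Definition spine (n s : nat) : rel nat := fun i j =>
  (j == i.+1) && (i != s) || (i == 0%N) && (j == n.-1).

Section Labels.
Variables (n j k : nat).
Hypotheses (n3 : (3 <= n)%N) (k3 : (3 <= k)%N).

(* [j] is l + 1, the length of the tail between C_n and the rest, and [k] is
   m - 1; the tail ends in [s], which is on C_n when [j] is 0. *)
Local Notation s := (n + j).-1.
Local Notation N := (n + j + k)%N.

(* The obligations of [chromsym_label], once the vertices are ordinals. *)
Local Ltac label_inj i i' :=
  rewrite /=; have /= := ltn_ord i; have /= := ltn_ord i'; move=> *;
  try (suff -> : i = i' by []; apply: val_inj => /=); lia.
Local Ltac label_bound i := rewrite /=; have /= := ltn_ord i; lia.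
Local Ltac adj_lia :=
  rewrite ?(@cycle_adjE k.+1) ?cycle_adjE // ?/path_adj ?(inj_eq inr_inj)
    -?val_eqE /edge /spine /=; lia.
Local Ltac label_adj i i' :=
  rewrite /=; have /= := ltn_ord i; have /= := ltn_ord i'; move=> *; adj_lia.

(** C_n is numbered backwards so that its vertex [ord0], where the tail starts,
    becomes n-1. *)
Lemma tadpole_label :
  chromsym (tadpole n (j + k)) =
  chromsym (edge_graph N (relU (spine n s) (edge s s.+1))).
Proof.
have -> : tadpole n (j + k) =
    @link (cycle_graph n) (path_graph (j + k).-1.+1) ord0 ord0.
  by rewrite /tadpole; case: (j + k)%N (leq_addl j k) => //; lia.
set G := link _ _.
pose f (x : 'I_n.-1.+1 + 'I_(j + k).-1.+1) :=
  match x with inl i => (n.-1 - i)%N | inr i => (n + i)%N end.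
apply: (@chromsym_label G _ _ f).
- by rewrite /= card_sum !card_ord; lia.
- by case=> i [] i'; label_inj i i'.
- by case=> i; label_bound i.
by case=> i [] i'; label_adj i i'.
Qed.

Lemma tadpole_cycle_label :
  chromsym (tadpole n j) * chromsym (cycle_graph k) =
  chromsym (edge_graph N (relU (spine n s) (edge s.+1 N.-1))).
Proof.
rewrite -chromsym_disjoint; case: j => [|j'].
  set G := disjoint_union _ _.
  pose f (x : 'I_n.-1.+1 + 'I_k.-1.+1) :=
    match x with inl i => (n.-1 - i)%N | inr i => (n + i)%N end.
  apply: (@chromsym_label G _ _ f).
  - by rewrite /= card_sum !card_ord; lia.
  - by case=> i [] i'; label_inj i i'.
  - by case=> i; label_bound i.
  by case=> i [] i'; label_adj i i'.
set G := disjoint_union _ _.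
pose f (x : 'I_n.-1.+1 + 'I_j'.+1 + 'I_k.-1.+1) :=
  match x with
  | inl (inl i) => (n.-1 - i)%N
  | inl (inr i) => (n + i)%N
  | inr i => (n + j'.+1 + i)%N
  end.
apply: (@chromsym_label G _ _ f).
- by rewrite /= !card_sum !card_ord; lia.
- by case=> [[] i|i] [[] i'|i']; label_inj i i'.
- by case=> [[] i|i]; label_bound i.
by case=> [[] i|i] [[] i'|i']; label_adj i i'.
Qed.

(** The short cycle is attached through its last number N-1, hence it is
    numbered backwards, and so is the path, which starts at that cycle. *)
Lemma dumbbell_short_label :
  chromsym (dumbbell k j n) =
  chromsym (edge_graph N
    (relU (relU (spine n s) (edge s N.-1)) (edge s.+1 N.-1))).
Proof.
case: j => [|j'] /=.
  set G := link _ _.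
  pose f (x : 'I_k.-1.+1 + 'I_n.-1.+1) :=
    match x with inl i => (n + k.-1 - i)%N | inr i => (n.-1 - i)%N end.
  apply: (@chromsym_label G _ _ f).
  - by rewrite /= card_sum !card_ord; lia.
  - by case=> i [] i'; label_inj i i'.
  - by case=> i; label_bound i.
  by case=> i [] i'; label_adj i i'.
set G := link _ _.
pose f (x : 'I_k.-1.+1 + 'I_j'.+1 + 'I_n.-1.+1) :=
  match x with
  | inl (inl i) => (n + j' + k - i)%N
  | inl (inr i) => (n + j' - i)%N
  | inr i => (n.-1 - i)%N
  end.
apply: (@chromsym_label G _ _ f).
- by rewrite /= !card_sum !card_ord; lia.
- by case=> [[] i|i] [[] i'|i']; label_inj i i'.
- by case=> [[] i|i]; label_bound i.
by case=> [[] i|i] [[] i'|i']; label_adj i i'.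
Qed.

(** Here the root of the long cycle is [s] itself and its two neighbours on the
    cycle are [s.+1] and N-1.  The cases are the two cycles sharing a vertex,
    joined by an edge, and joined by a path. *)
Lemma dumbbell_long_label :
  chromsym (dumbbell k.+1 (j%:Z - 1) n) =
  chromsym (edge_graph N
    (relU (relU (spine n s) (edge s s.+1)) (edge s N.-1))).
Proof.
case: j => [|[|j']].
- pose V := {y : 'I_n.-1.+1 | y != ord0}.
  (* [h] is abstract so that the number of a vertex has a single form after
     the vertex type of the wedge is unfolded. *)
  have [h hE] : exists h : V -> nat, forall u, h u = sval u.
    by exists (fun u => sval u).
  have h_inj : injective h by move=> u v; rewrite !hE => /ord_inj/val_inj.
  have h_bound u : (0 < h u < n)%N.
    by have := valP u; rewrite hE -val_eqE /=; have := ltn_ord (sval u); lia.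
  rewrite /=; set G := wedge _ _.
  pose f (x : 'I_k.+1 + V) :=
    match x with inl i => (n.-1 + i)%N | inr u => (n.-1 - h u)%N end.
  apply: (@chromsym_label G _ _ f).
  - rewrite /= card_sum card_sig !card_ord (eq_card (B := predC1 ord0)) //.
    by rewrite cardC1 card_ord; lia.
  - case=> i [] i' /=; first [have /= := ltn_ord i | have := h_bound i];
      first [have /= := ltn_ord i' | have := h_bound i'] => *;
      try (suff -> : i = i' by []; first [apply: ord_inj | apply: h_inj] => /=);
      lia.
  - by case=> i /=; first [have /= := ltn_ord i | have := h_bound i]; lia.
  case=> i [] i' /=; first [have /= := ltn_ord i | have := h_bound i];
    first [have /= := ltn_ord i' | have := h_bound i'] => *;
    rewrite ?(@cycle_adjE k.+1) ?cycle_adjE // -?hE -?val_eqE /edge /spine /=;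
    lia.
- rewrite subrr /=; set G := link _ _.
  pose f (x : 'I_k.+1 + 'I_n.-1.+1) :=
    match x with inl i => (n + i)%N | inr i => (n.-1 - i)%N end.
  apply: (@chromsym_label G _ _ f).
  - by rewrite /= card_sum !card_ord; lia.
  - by case=> i [] i'; label_inj i i'.
  - by case=> i; label_bound i.
  by case=> i [] i'; label_adj i i'.
have -> : j'.+2%:Z - 1 = j'.+1%:Z by lia.
rewrite /=; set G := link _ _.
pose f (x : 'I_k.+1 + 'I_j'.+1 + 'I_n.-1.+1) :=
  match x with
  | inl (inl i) => (n + j'.+1 + i)%N
  | inl (inr i) => (n + j' - i)%N
  | inr i => (n.-1 - i)%N
  end.
apply: (@chromsym_label G _ _ f).
- by rewrite /= !card_sum !card_ord; lia.
- by case=> [[] i|i] [[] i'|i']; label_inj i i'.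
- by case=> [[] i|i]; label_bound i.
by case=> [[] i|i] [[] i'|i']; label_adj i i'.
Qed.

End Labels.

(** * The recurrence *)

Theorem lemma4p2 (m n : nat) (l : int)
    (hm : (3 < m)%N) (hn : (3 <= n)%N) (hl : -1 <= l) :
  chromsym (dumbbell m l n) =
    chromsym (dumbbell m.-1 (l + 1) n)
    + chromsym (tadpole n (absz (m%:Z + l)))
    - chromsym (tadpole n (absz (l + 1))) * chromsym (cycle_graph m.-1).
Proof.
have [j lE] : exists j : nat, l = j%:Z - 1 by exists (absz (l + 1)); lia.
have -> : absz (m%:Z + l) = (j + m.-1)%N by lia.
have -> : l + 1 = j%:Z by lia.
rewrite lE absz_nat; case: m hm => // k k3 /=.
rewrite dumbbell_long_label // dumbbell_short_label // tadpole_label //.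
rewrite tadpole_cycle_label //.
have aN : ((n + j).-1 < n + j + k)%N by lia.
have bN : ((n + j).-1.+1 < n + j + k)%N by lia.
have cN : ((n + j + k).-1 < n + j + k)%N by lia.
by apply: (@triple_deletion _ _ (Ordinal aN) (Ordinal bN) (Ordinal cN)) => /=;
  lia.
Qed.
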